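(* Let $X=(X_t)_{t\ge 0}$ be either a standard Brownian motion or, more generally, a recurrent diffusion process on $\mathbb R$, started at $X_0=0$ under a probability measure $\mathsf P$, let $\mu$ be a probability measure on $(\mathbb R,\mathcal B(\mathbb R))$ such that $\mu(\{0\})=0$, let $(b,c)$ be the pair of boundary functions embedding $\mu$ into $X$ (as described in the context), and let $\tau=\tau_{b,c}=\inf\{t>0 : X_t\ge b(t)\text{ or }X_t\le c(t)\}$. Let $\sigma$ be any stopping time such that $X_\sigma\sim X_\tau$ (equality in law) and $\sigma\le\tau$ $\mathsf P$-a.s. Then $\sigma=\tau$ $\mathsf P$-a.s.
   Context: $\mathbb R_+=[0,\infty)$ and $\mathbb R_-=(-\infty,0]$; $\operatorname{supp}(\mu)$ is the (closed) topological support of $\mu$; ''increasing'' and ''decreasing'' are meant in the weak sense. Pair of boundary functions embedding $\mu$ into $X$: functions $b,c$ on $(0,\infty)$ such that $\tau_{b,c}<\infty$ a.s., $X_{\tau_{b,c}}$ has law $\mu$, and - if $\operatorname{supp}(\mu)\subseteq\mathbb R_+$, then $b:(0,\infty)\to\mathbb R$ is left-continuous and increasing and $c\equiv-\infty$; - if $\operatorname{supp}(\mu)\subseteq\mathbb R_-$, then $b\equiv+\infty$ and $c:(0,\infty)\to\mathbb R$ is left-continuous and decreasing; - otherwise, $b:(0,\infty)\to\mathbb R\cup\{+\infty\}$ is left-continuous and increasing and $c:(0,\infty)\to\mathbb R\cup\{-\infty\}$ is left-continuous and decreasing. (Such a pair exists and is unique.) A diffusion process on $\mathbb R$ is understood in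 the sense of Itô and McKean: a time-homogeneous strong Markov process with state space $\mathbb R$ and continuous sample paths; $\mathsf P_x$ denotes the law under which it starts at $x$ (so $\mathsf P=\mathsf P_0$). It is recurrent if $\mathsf P_x(\tau_y<\infty)=1$ for all $x,y\in\mathbb R$, where $\tau_y=\inf\{t>0 : X_t=y\}$. Stopping times are stopping times of $X$, i.e. with respect to the natural filtration of $X$ (completed and made right-continuous). *)

(* Defs.v *)
From mathcomp Require Import all_boot all_order all_algebra.
From mathcomp Require Import all_classical all_reals all_analysis.
From mathcomp Require Import measurable_realfun.

Set Implicit Arguments.
Unset Strict Implicit.
Unset Printing Implicit Defensive.

Import Order.TTheory GRing.Theory Num.Theory.
Import numFieldNormedType.Exports.

Local Open Scope classical_set_scope.
Local Open Scope ring_scope.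

(* A real-valued process is a map [X : R -> Omega -> R]; only the values at
   times [t >= 0] are ever used.  Random times take values in [\bar R]. *)

Section processes.
Context {R : realType} {d : measure_display} {Omega : measurableType d}.
Implicit Types (P : probability Omega R) (X : R -> Omega -> R)
  (F : R -> set (set Omega)) (S : Omega -> \bar R).

Definition continuous_process X : Prop :=
  (forall t, 0 <= t -> measurable_fun setT (X t)) /\
  (forall w, {within `[0, +oo[, continuous (fun t => X t w)}).

Definition sigma_of X (J : set R) : set (set Omega) :=
  <<s [set A | exists (s : R) (B : set R),
         [/\ J s, measurable B & A = X s @^-1` B] ] >>.

Definition natural_filtration X (t : R) : set (set Omega) := sigma_of X `[0, t].

Definition completed_filtration P F (t : R) : set (set Omega) :=
  <<s F t `|` P.-negligible >>.

Definition right_filtration F (t : R) : set (set Omega) :=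
  \bigcap_(u in `]t, +oo[) F u.

Definition augmented_filtration P X : R -> set (set Omega) :=
  right_filtration (completed_filtration P (natural_filtration X)).

Definition stopping_time F S : Prop :=
  (forall w, 0 <= S w)%E /\
  (forall t, 0 <= t -> F t [set w | (S w <= t%:E)%E]).

Definition stopped_sigma F S : set (set Omega) :=
  [set A | forall t, 0 <= t -> F t (A `&` [set w | (S w <= t%:E)%E])].

(* Meaningful where [S w < +oo]. *)
Definition value_at X S (w : Omega) : R := X (fine (S w)) w.

(* The law of [X_S] under the completion of [P]: a stopping time of the
   completed filtration need only be measurable for the completion, on which
   the outer measure [P^*] is the completed measure (and [P^*] equals [P] on
   measurable sets). *)
Definition law_at P X S (B : set R) : \bar R :=
  (P^*)%mu [set w | (S w < +oo)%E /\ B (value_at X S w)].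

Definition equal_in_law P X S S' : Prop :=
  forall B : set R, measurable B -> law_at P X S B = law_at P X S' B.

(* inf {t > 0 : D t (X_t)}, equal to +oo if there is no such t. *)
Definition hitting_time X (D : R -> R -> Prop) (w : Omega) : \bar R :=
  ereal_inf [set t%:E | t in [set t : R | 0 < t /\ D t (X t w)] ].

Record standard_brownian_motion P X : Prop := {
  bm_process : continuous_process X;
  bm_start : P [set w | X 0 w = 0] = 1%E;
  bm_normal : forall (s t : R) (B : set R), 0 <= s -> s < t -> measurable B ->
    P [set w | B (X t w - X s w)] = normal_prob 0 (Num.sqrt (t - s)) B;
  bm_indep : forall (s t : R) (A : set Omega) (B : set R),
    0 <= s -> s < t -> natural_filtration X s A -> measurable B ->
    P (A `&` [set w | B (X t w - X s w)]) =
    (P A * P [set w | B (X t w - X s w)%R])%E }.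

(* [diff_strong_markov] unfolds the defining property of the conditional
   probability in
     P_x (X_{S+t} \in B | F_{S+}) = P_{X_S} (X_t \in B)  P_x-a.s. on {S < oo},
   for [S] a stopping time of the right-continuous natural filtration. *)
Record diffusion (Px : R -> probability Omega R) X : Prop := {
  diff_process : continuous_process X;
  diff_start : forall x, Px x [set w | X 0 w = x] = 1%E;
  diff_measurable : forall A : set Omega, sigma_of X `[0, +oo[ A ->
    measurable_fun setT (fun x : R => Px x A);
  diff_strong_markov : forall (x : R) S (t : R) (A : set Omega) (B : set R),
    let F := right_filtration (natural_filtration X) in
    stopping_time F S -> stopped_sigma F S A -> 0 <= t -> measurable B ->
    let A' := A `&` [set w | (S w < +oo)%E] in
    Px x (A' `&` [set w | B (X (fine (S w) + t) w)]) =
    (\int[Px x]_(w in A') Px (value_at X S w) (X t @^-1` B))%E }.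

Definition recurrent (Px : R -> probability Omega R) X : Prop :=
  forall x y,
    Px x [set w | (hitting_time X (fun _ z => z = y) w < +oo)%E] = 1%E.

End processes.

Section boundaries.
Context {R : realType}.
Implicit Types (b c : R -> \bar R).

Definition support (mu : probability (measurableTypeR R) R) : set R :=
  [set x | forall U : set R, open U -> U x -> (0 < mu U)%E].

Definition left_continuous_pos (f : R -> \bar R) : Prop :=
  forall t, 0 < t -> f s @[s --> t^'-] --> f t.

Definition increasing_pos (f : R -> \bar R) : Prop :=
  forall s t, 0 < s -> s <= t -> (f s <= f t)%E.

Definition decreasing_pos (f : R -> \bar R) : Prop :=
  forall s t, 0 < s -> s <= t -> (f t <= f s)%E.

(* The boundaries are functions on (0,oo): their values at [t <= 0] are
   irrelevant.  When [mu [set 0] = 0] the three cases are exclusive. *)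
Definition boundary_shape (mu : probability (measurableTypeR R) R) b c : Prop :=
  [/\ support mu `<=` `[0, +oo[ ->
        [/\ forall t, 0 < t -> b t \is a fin_num,
            left_continuous_pos b,
            increasing_pos b &
            forall t, 0 < t -> c t = -oo%E],
      support mu `<=` `]-oo, 0] ->
        [/\ forall t, 0 < t -> b t = +oo%E,
            forall t, 0 < t -> c t \is a fin_num,
            left_continuous_pos c &
            decreasing_pos c] &
      ~ support mu `<=` `[0, +oo[ -> ~ support mu `<=` `]-oo, 0] ->
        [/\ forall t, 0 < t -> b t != -oo%E /\ c t != +oo%E,
            left_continuous_pos b,
            increasing_pos b,
            left_continuous_pos c &
            decreasing_pos c] ].

Definition boundary_time {d : measure_display} {Omega : measurableType d}
    (X : R -> Omega -> R) b c : Omega -> \bar R :=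
  hitting_time X (fun t x => (b t <= x%:E)%E \/ (x%:E <= c t)%E).

Definition embedding_boundaries {d : measure_display}
    {Omega : measurableType d} (P : probability Omega R) (X : R -> Omega -> R)
    (mu : probability (measurableTypeR R) R) b c : Prop :=
  [/\ boundary_shape mu b c,
      {ae P, forall w, (boundary_time X b c w < +oo)%E} &
      forall B : set R, measurable B ->
        law_at P X (boundary_time X b c) B = mu B].

End boundaries.

(* Main.v *)
Require Import Defs.
From mathcomp Require Import all_boot all_order all_algebra.
From mathcomp Require Import all_classical all_reals all_analysis.

Import Order.TTheory GRing.Theory Num.Theory.
Import numFieldNormedType.Exports.

Local Open Scope classical_set_scope.
Local Open Scope ring_scope.

(** Write [tau] for the boundary time and [U_t = ]c(t), b(t)[] for the open gap
    between the boundaries at time [t]; as [b] increases and [c] decreases,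
    [U_t] grows with [t].  The argument is pathwise, followed by one comparison
    of laws.

    On a path with [0 < sigma <= tau < +oo], if [X_tau] lies in [U_t] then so
    does [X_sigma] ([between_value_at]).  Indeed [X_tau] is outside [U_tau] ([boundary_time_attained]), so [tau < t] by monotonicity
    of the gap; if [X_sigma] were outside [U_t], it would be outside the
    smaller gap [U_sigma], and the path would already have reached a boundary
    at time [sigma], so that [sigma = tau].  Since [X_sigma] and [X_tau] have
    the same law, such a one-sided implication is almost surely an equivalence
    ([law_at_value_imply]), simultaneously for all rational [t > 0].

    If now [sigma < tau], choose a rational [t] with [sigma < t < tau].  Then
    [X_tau] is outside [U_tau], hence outside [U_t], and by the equivalence
    [X_sigma] is outside [U_t], hence outside [U_sigma]; so the path meets a
    boundary at time [sigma < tau], a contradiction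
    ([eq_boundary_time]).  Finally [sigma > 0] almost surely, because
    [X_0 = 0] while the common law [mu] of [X_sigma] and [X_tau] gives no mass
    to the point 0. *)

(** * Outer measure and almost sure complementarity *)

(** Arbitrary sets enter because [law_at] is an outer measure; a measurable hull
    of the same mass brings the computation back to measurable sets. *)
Lemma mu_ext_hull {d : measure_display} {T : measurableType d}
    {R : realType} (mu : {measure set T -> \bar R}) (A : set T) :
  exists H : set T, [/\ measurable H, A `<=` H & mu H = (mu^*)%mu A].
Proof.
have H_ge H : measurable H -> A `<=` H -> ((mu^*)%mu A <= mu H)%E.
  by move=> mH AH; rewrite -(measurable_mu_extE mu mH); exact: le_mu_ext.
have [muAoo|muA_noo] := eqVneq ((mu^*)%mu A) +oo%E.
  exists setT; split => //; rewrite muAoo.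
  by apply/eqP; rewrite -leye_eq -muAoo; exact: H_ge.
have muA_fin : (mu^*)%mu A \is a fin_num.
  by rewrite ge0_fin_numE ?ltey// mu_ext_ge0.
have approx (n : nat) : exists H : set T,
    [/\ measurable H, A `<=` H & (mu H <= (mu^*)%mu A + n.+1%:R^-1%:E)%E].
  have n1_gt0 : (0 : R) < n.+1%:R^-1 by rewrite invr_gt0.
  have [_ [F [mF AF] <-] Flt] := lb_ereal_inf_adherent n1_gt0 muA_fin.
  exists (\bigcup_k F k); split => //; first exact: bigcupT_measurable.
  apply: le_trans (ltW Flt).
  by apply: measure_sigma_subadditive => //; exact: bigcupT_measurable.
have [H_ H_P] := choice approx.
have mH : measurable (\bigcap_n H_ n).
  by apply: bigcapT_measurable => n; case: (H_P n).
have AH : A `<=` \bigcap_n H_ n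
  by move=> x Ax n _; have [_ AHn _] := H_P n; exact: AHn.
exists (\bigcap_n H_ n); split => //.
apply/eqP; rewrite eq_le H_ge// andbT leNgt; apply/negP => lt_muA.
have le_muH (n : nat) :
    (mu (\bigcap_n H_ n) <= (mu^*)%mu A + n.+1%:R^-1%:E)%E.
  have [mHn _ Hn_le] := H_P n; apply: le_trans Hn_le.
  by apply: le_measure; rewrite ?inE//; exact: bigcap_inf.
have muH_fin : mu (\bigcap_n H_ n) \is a fin_num.
  rewrite ge0_fin_numE//; apply: le_lt_trans (le_muH 0%N) _.
  by rewrite ltey_eq fin_numD muA_fin.
move: lt_muA le_muH; rewrite -(fineK muA_fin) -(fineK muH_fin) lte_fin.
move=> /ltr_add_invr[k lt_k] /(_ k).
by rewrite -EFinD lee_fin leNgt lt_k.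
Qed.

(** Two sets that cover the space while sharing a total mass of at most 1 have no
    mass left for an overlap, by inclusion-exclusion on their hulls.  This stands
    in for measurability of the two sets. *)
Lemma negligibleI_cover {d : measure_display} {T : measurableType d}
    {R : realType} {P : probability T R} {A B : set T} :
  ((P^*)%mu A + (P^*)%mu B <= 1)%E -> {ae P, forall w, A w \/ B w} ->
  P.-negligible (A `&` B).
Proof.
have [A' [mA' AA' <-]] := mu_ext_hull P A.
have [B' [mB' BB' <-]] := mu_ext_hull P B.
move=> le1 [N [mN PN0 subN]].
exists (A' `&` B'); split; [exact: measurableI| |exact: setISS].
have PU : P (A' `|` B') = 1%E.
  rewrite -(measureU0 (measurableU _ _ mA' mB') mN PN0).
  rewrite -[RHS](probability_setT P).
  congr (P _); apply/seteqP; split => // w _.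
  have [[/AA'|/BB']|nAB] := pselect (A w \/ B w); [by do 2!left|by left; right|].
  by right; exact: subN.
have PI_fin : P (A' `&` B') \is a fin_num.
  by apply: fin_num_measure; exact: measurableI.
have PI_le : (1 + P (A' `&` B') <= 1)%E.
  by rewrite -{1}PU measureUfinl ?subeK// -ge0_fin_numE// fin_num_measure.
apply/eqP; rewrite eq_le measure_ge0 andbT.
by move: PI_le; rewrite -leeBrDl// subee.
Qed.

(** * The gap between the boundaries along a path *)

Section path.
Context {R : realType} {d : measure_display} {Omega : measurableType d}.
Implicit Types (X : R -> Omega -> R) (b c : R -> \bar R) (w : Omega) (t : R).

Definition between b c t : set R :=
  [set x | (c t < x%:E)%E /\ (x%:E < b t)%E].

Lemma not_between {b c t} {x : R} :
  ~ between b c t x <-> (b t <= x%:E)%E \/ (x%:E <= c t)%E.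
Proof.
rewrite /between/= not_andP; split.
  by move=> [/negP|/negP]; rewrite -leNgt; [right|left].
by move=> [bx|xc]; [right|left]; apply/negP; rewrite -leNgt.
Qed.

Lemma open_between b c t : open (between b c t).
Proof. by apply: openI; [exact: open_ereal_gt|exact: open_ereal_lt]. Qed.

Lemma between_subset {b c s t} : increasing_pos b -> decreasing_pos c ->
  0 < s -> s <= t -> between b c s `<=` between b c t.
Proof.
move=> b_inc c_dec s0 st x [cx xb]; split.
  exact: le_lt_trans (c_dec _ _ s0 st) cx.
exact: lt_le_trans xb (b_inc _ _ s0 st).
Qed.

Lemma boundary_time_le {X b c w t} :
  0 < t -> ~ between b c t (X t w) -> (boundary_time X b c w <= t%:E)%E.
Proof.
by move=> t0 /not_between Dt; apply: ereal_inf_lbound; exists t.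
Qed.

(** The gap at time [t] is open and contained in every later gap, so a path that
    is inside it at time [t] stays clear of both boundaries for a while after
    [t], and the infimum would be larger than [t]. *)
Lemma boundary_time_attained {X b c w t} :
  increasing_pos b -> decreasing_pos c ->
  {within `[0, +oo[, continuous (fun s => X s w)} ->
  0 < t -> boundary_time X b c w = t%:E -> ~ between b c t (X t w).
Proof.
move=> b_inc c_dec cX t0 taut btw.
have cXt : {for t, continuous (fun s => X s w)}.
  by move/continuous_within_itvcyP: cX => [+ _]; apply; rewrite in_itv/= t0.
have /nbhs_ballP[e /= e0 eP] : \forall s \near t, between b c t (X s w).
  by apply: cXt; apply: open_nbhs_nbhs; split => //; exact: open_between.
suff : ((t + e)%:E <= boundary_time X b c w)%E.
  by rewrite taut lee_fin gerDl leNgt e0.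
apply: le_ereal_inf_tmp => _ [s [s0 Ds] <-]; rewrite lee_fin leNgt.
apply/negP => lt_s.
move/not_between : Ds => nbtw; apply: (nbtw).
have le_ts : t <= s by rewrite -lee_fin -taut; exact: boundary_time_le.
apply: (between_subset b_inc c_dec t0 le_ts); apply: eP.
by rewrite /ball/= ler0_norm ?subr_le0// opprB ltrBlDl.
Qed.

(** The hypothesis on [X_tau] forces [tau w < t], since [X_tau] is outside the gap
    at time [tau w].  Were [X_sigma] outside the gap at time [t], it would be
    outside the smaller one at time [sigma w]; then [sigma w = tau w] and the two
    values coincide. *)
Lemma between_value_at {X b c} {sigma : Omega -> \bar R} {w t} :
  increasing_pos b -> decreasing_pos c ->
  {within `[0, +oo[, continuous (fun s => X s w)} ->
  let tau := boundary_time X b c in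
  (0 < sigma w)%E -> (sigma w <= tau w)%E -> (tau w < +oo)%E ->
  0 < t -> between b c t (value_at X tau w) ->
  between b c t (value_at X sigma w).
Proof.
move=> b_inc c_dec cX tau; rewrite /value_at.
case Esig : (sigma w) => [s| |]//; case Etau : (tau w) => [u| |]//=.
rewrite lte_fin lee_fin => s0 su _ t0 btw.
have u0 : 0 < u by exact: lt_le_trans su.
have nbtw := boundary_time_attained b_inc c_dec cX u0 Etau.
have lt_ut : u < t.
  rewrite ltNge; apply/negP => tu.
  exact/nbtw/(between_subset b_inc c_dec t0 tu).
apply: contrapT => nbtw_s.
suff us : u = s by rewrite -us in nbtw_s.
apply/eqP; rewrite eq_le su andbT -lee_fin -Etau.
apply: boundary_time_le => // btw_s; apply: nbtw_s.
exact: (between_subset b_inc c_dec s0 (le_trans su (ltW lt_ut))).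
Qed.

(** If [sigma w < tau w], the gap at any time strictly in between contains
    [X_sigma] but not [X_tau], against the last hypothesis;
    rational times suffice, which keeps the exceptional set negligible. *)
Lemma eq_boundary_time {X b c} {sigma : Omega -> \bar R} {w} :
  increasing_pos b -> decreasing_pos c ->
  {within `[0, +oo[, continuous (fun s => X s w)} ->
  let tau := boundary_time X b c in
  (0 < sigma w)%E -> (sigma w <= tau w)%E -> (tau w < +oo)%E ->
  (forall q : rat, 0 < ratr q :> R ->
     between b c (ratr q) (value_at X sigma w) ->
     between b c (ratr q) (value_at X tau w)) ->
  sigma w = tau w.
Proof.
move=> b_inc c_dec cX tau; rewrite /value_at.
case Esig : (sigma w) => [s| |]//; case Etau : (tau w) => [u| |]//=.
rewrite lte_fin lee_fin => s0 su _ btwP.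
have [us|lt_su] := leP u s; first by congr EFin; apply/eqP; rewrite eq_le su us.
have [q] := rat_in_itvoo lt_su; rewrite in_itv/= => /andP[sq qu].
have q0 : 0 < ratr q :> R by exact: lt_trans sq.
have u0 : 0 < u by exact: lt_trans lt_su.
exfalso; apply: (boundary_time_attained b_inc c_dec cX u0 Etau).
apply: (between_subset b_inc c_dec q0 (ltW qu)); apply: btwP => //.
apply: (between_subset b_inc c_dec s0 (ltW sq)).
apply: contrapT => nbtw.
have := boundary_time_le s0 nbtw.
by rewrite -/tau Etau lee_fin leNgt lt_su.
Qed.

End path.

(** * Comparison of laws *)

Section law.
Context {R : realType} {d : measure_display} {Omega : measurableType d}.
Implicit Types (X : R -> Omega -> R) (b c : R -> \bar R) (w : Omega) (t : R).

(** Identically infinite boundaries are monotone too, so the three cases of the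
    shape condition can be treated at once. *)
Lemma boundary_shape_monotone {mu : probability (measurableTypeR R) R} {b c} :
  boundary_shape mu b c -> increasing_pos b /\ decreasing_pos c.
Proof.
have le_cst (f : R -> \bar R) k : (forall t, 0 < t -> f t = k) ->
    increasing_pos f /\ decreasing_pos f.
  move=> fk; split=> s t s0 st; have t0 : 0 < t by exact: lt_le_trans st.
    by rewrite !fk.
  by rewrite !fk.
move=> [pos neg two].
have [/pos[_ _ b_inc /le_cst[_ ?]]//|np] :=
  pselect (Defs.support mu `<=` `[0, +oo[).
have [/neg[/le_cst[? _] _ _ c_dec]//|nn] :=
  pselect (Defs.support mu `<=` `]-oo, 0]).
by have [_ _ ? _ ?] := two np nn.
Qed.

(** Given the one-sided implication, the events that [X_S'] is in [U] and that
    [X_S] is outside [U] cover the space, while their masses [mu U] and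
    [mu (~` U)] add up to 1; so they almost surely exclude each other. *)
Lemma law_at_value_imply {P : probability Omega R} {X} {S S' : Omega -> \bar R}
    {mu : probability (measurableTypeR R) R} {U : set R} :
  (forall B : set R, measurable B -> law_at P X S B = mu B) ->
  (forall B : set R, measurable B -> law_at P X S' B = mu B) ->
  {ae P, forall w, (S w < +oo)%E} -> {ae P, forall w, (S' w < +oo)%E} ->
  measurable U ->
  {ae P, forall w, U (value_at X S w) -> U (value_at X S' w)} ->
  {ae P, forall w, U (value_at X S' w) -> U (value_at X S w)}.
Proof.
move=> lawS lawS' Sfin S'fin mU UUS.
have mUC := measurableC mU.
have le1 : (law_at P X S' U + law_at P X S (~` U) <= 1)%E.
  rewrite lawS'// lawS// -measureU//; last by rewrite setICr.
  by rewrite setUv; apply: probability_le1; exact: measurableT.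
have [|N [mN PN0 subN]] := negligibleI_cover le1.
  move: UUS Sfin S'fin; apply: filterS3 => w UUSw Sw S'w.
  by have [/UUSw|] := pselect (U (value_at X S w)); [left|right].
have negN : {ae P, forall w, ~ N w}.
  by exists N; split => // w /contrapT.
move: negN Sfin S'fin; apply: filterS3 => w nNw Sw S'w US'w.
by apply: contrapT => nUS; exact/nNw/subN.
Qed.

Lemma continuous_start0_ae {P : probability Omega R} {X} :
  standard_brownian_motion P X \/
    (exists Px : R -> probability Omega R,
      [/\ diffusion Px X, recurrent Px X & Px 0 = P]) ->
  continuous_process X /\ {ae P, forall w, X 0 w = 0}.
Proof.
move=> HX.
have [cX PX0] : continuous_process X /\ P [set w | X 0 w = 0] = 1%E.
  case: HX => [[? ? _ _]|[Px [[? start _ _] _ <-]]]; split => //; exact: start.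
have mX0 : measurable [set w | X 0 w = 0].
  rewrite -[X in measurable X]setTI.
  exact: (cX.1 0 (lexx _) measurableT [set 0] (measurable_set1 _)).
split => //; exists (~` [set w | X 0 w = 0]); split => //.
  exact: measurableC.
by rewrite probability_setC// PX0 subee.
Qed.

End law.

Theorem proposition11 (R : realType) (d : measure_display)
  (Omega : measurableType d) (P : probability Omega R) (X : R -> Omega -> R)
  (mu : probability (measurableTypeR R) R) (b c : R -> \bar R)
  (sigma : Omega -> \bar R)
  (HX : standard_brownian_motion P X \/
        exists Px : R -> probability Omega R,
          [/\ diffusion Px X, recurrent Px X & Px 0 = P])
  (Hmu0 : mu [set 0] = 0%E)
  (Hbc : embedding_boundaries P X mu b c)
  (Hsigma : stopping_time (augmented_filtration P X) sigma)
  (Hlaw : equal_in_law P X sigma (boundary_time X b c))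
  (Hle : {ae P, forall w, (sigma w <= boundary_time X b c w)%E}) :
  {ae P, forall w, sigma w = boundary_time X b c w}.
Proof.
have [[_ cX] X0] := continuous_start0_ae HX.
set tau := boundary_time X b c in Hlaw Hle *.
have [/boundary_shape_monotone[b_inc c_dec] tau_fin law_tau] := Hbc.
have law_sigma B : measurable B -> law_at P X sigma B = mu B.
  by move=> mB; rewrite Hlaw// law_tau.
have sigma_fin : {ae P, forall w, (sigma w < +oo)%E}.
  by move: Hle tau_fin; apply: filterS2 => w; exact: le_lt_trans.
have sigma_gt0 : {ae P, forall w, (0 < sigma w)%E}.
  have Xsigma : {ae P, forall w, value_at X sigma w <> 0}.
    have [H [mH subH PH]] := mu_ext_hull P
      [set w | (sigma w < +oo)%E /\ [set 0] (value_at X sigma w)].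
    have PH0 : P H = 0 by rewrite PH -[LHS]/(law_at P X sigma [set 0]) law_sigma.
    have nH : {ae P, forall w, ~ H w} by exists H; split => // w /contrapT.
    by move: nH sigma_fin; apply: filterS2 => w nHw sfin Xs0; exact/nHw/subH.
  move: Xsigma X0; apply: filterS2 => w Xs Xw0.
  rewrite lt_neqAle Hsigma.1 andbT; apply/eqP => s0; apply: Xs.
  by rewrite /value_at -s0.
have ordered : {ae P, forall w,
    [/\ (0 < sigma w)%E, (sigma w <= tau w)%E & (tau w < +oo)%E]}.
  by move: sigma_gt0 Hle tau_fin; apply: filterS3 => w.
(* Positive rational times, enumerated by [unpickle] so that a countable union
   of negligible sets applies; indices coding no rational give the time 0. *)
have same_side : {ae P, forall w (n : nat), let q := odflt 0%Q (unpickle n) in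
    0 < ratr q :> R -> between b c (ratr q) (value_at X sigma w) ->
    between b c (ratr q) (value_at X tau w)}.
  apply: ae_foralln => n /=; set q : R := ratr _.
  have [q0|nq0] := pselect (0 < q); last exact/aeW.
  suff : {ae P, forall w, between b c q (value_at X sigma w) ->
     between b c q (value_at X tau w)}.
    by apply: filterS => w + _.
  apply: (law_at_value_imply law_tau law_sigma) => //.
    by apply: measurable_realfun.open_measurable; exact: open_between.
  apply: filterS ordered => w [s0 le_w fin_w].
  exact: between_value_at.
move: same_side ordered; apply: filterS2 => w side [s0 le_w fin_w].
apply: (eq_boundary_time b_inc c_dec) => // q.
by have := side (pickle q); rewrite pickleK.
Qed.
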